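(* Let $1\le p<\infty$, let $A\in\mathbb{R}^{n\times d}$, $b\in\mathbb{R}^n$, and suppose that $\operatorname{rank}(A)\le r$, where $1\le r\le n$. Let $\Omega\in\mathbb{R}^{n\times k}$ be an $(r,\alpha,\rho)$-OSI${}_p$. Then, for every $t\ge1$, the sketch-and-solve estimator $\widetilde x\in\operatorname{argmin}_{x\in\mathbb{R}^d}\|\Omega^\top(Ax-b)\|_p$ satisfies \[ \mathbb{P}\left\{ \|A\widetilde x-b\|_p \le \left(1+2\left(\frac{t}{\alpha}\right)^{1/p}\right) \min_{x\in\mathbb{R}^d} \|Ax-b\|_p \right\} \ge 1-\rho-t^{-1}. \] In particular, if $0<\delta<1$, $\rho\le \delta/2$, and $t=2/\delta$, then \[ \mathbb{P}\left\{ \|A\widetilde x-b\|_p \le \left(1+2\left(\frac{2}{\alpha\delta}\right)^{1/p}\right) \min_{x\in\mathbb{R}^d} \|Ax-b\|_p \right\} \ge 1-\delta. \]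
   Context: $\|\cdot\|_p$ is the $\ell_p$ norm. Definition (OSI${}_p$). Given $s\in\mathbb{N}$, $\alpha\in(0,1]$, and $\rho\in[0,1)$, a random matrix $\Omega\in\mathbb{R}^{n\times k}$ is an $(s,\alpha,\rho)$-OSI${}_p$ if (i) ($p$-isotropy) $\mathbb{E}[\|\Omega^\top z\|_p^p]=\|z\|_p^p$ for every $z\in\mathbb{R}^n$; and (ii) (injectivity) for every fixed $s$-dimensional subspace $V\subseteq\mathbb{R}^n$, $\mathbb{P}\{\|\Omega^\top v\|_p^p\ge\alpha\|v\|_p^p\text{ for all }v\in V\}\ge1-\rho$. *)

(* Defs.v *)
From HB Require Import structures.
From mathcomp Require Import all_boot all_order all_algebra.
From mathcomp Require Import all_classical all_reals all_analysis.

Set Implicit Arguments.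
Unset Strict Implicit.
Unset Printing Implicit Defensive.

Import Order.TTheory GRing.Theory Num.Theory.
Import numFieldNormedType.Exports.

Local Open Scope classical_set_scope.
Local Open Scope ring_scope.

Definition lpnorm (R : realType) (p : R) (n : nat) (z : 'cV[R]_n) : R :=
  (\sum_(i < n) `|z i 0| `^ p) `^ p^-1.

Definition random_matrix (disp : measure_display) (T : measurableType disp)
    (R : realType) (n k : nat) (X : T -> 'M[R]_(n, k)) : Prop :=
  forall i j, measurable_fun setT (fun w => X w i j).

(* The event in [injectivity] is measurable for a random matrix [Omega]: by
   continuity in v, a countable dense subset of V suffices. *)
Record OSI (disp : measure_display) (T : measurableType disp) (R : realType)
    (P : probability T R) (p : R) (n k : nat) (s : nat) (alpha rho : R)
    (Omega : T -> 'M[R]_(n, k)) : Prop := {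
  OSI_random : random_matrix Omega ;
  OSI_isotropy : forall z : 'cV[R]_n,
    ('E_P[(fun w => lpnorm p ((Omega w)^T *m z) `^ p)%R])%E
      = (lpnorm p z `^ p)%:E ;
  OSI_injectivity : forall V : {vspace 'cV[R]_n}, (\dim V = s)%N ->
    ((1 - rho)%:E <=
      P [set w | forall v : 'cV[R]_n, v \in V ->
           (alpha * lpnorm p v `^ p <= lpnorm p ((Omega w)^T *m v) `^ p)%R])%E
}.

Definition argmin (X : Type) (R : realType) (f : X -> R) : set X :=
  [set x | forall y, f x <= f y].

Definition is_min (R : realType) (S : set R) (m : R) : Prop :=
  S m /\ lbound S m.

(* Main.v *)
Require Import Defs.
From HB Require Import structures.
From mathcomp Require Import all_boot all_order all_algebra.
From mathcomp Require Import all_classical all_reals all_analysis.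
From mathcomp Require Import measurable_realfun ring lra.

Set Implicit Arguments.
Unset Strict Implicit.
Unset Printing Implicit Defensive.

Import Order.TTheory GRing.Theory Num.Theory.
Import numFieldNormedType.Exports.

Local Open Scope classical_set_scope.
Local Open Scope ring_scope.

(** Let [x0] be a minimiser, [z0 = A x0 - b], and [V] an [r]-dimensional space
    containing the range of [A]. By isotropy and Markov's inequality,
    [|Omega^T z0|^p <= t |z0|^p] off an event of probability [1 / t]; by
    injectivity on [V], [alpha |v|^p <= |Omega^T v|^p] for [v = A (xt - x0)]
    off an event of probability [rho]. As [Omega^T v] is the difference of the
    sketched residuals of [xt] and [x0], and [xt] is optimal for the sketch,
    [|Omega^T v| <= 2 |Omega^T z0|], whence [|v| <= 2 (t / alpha)^(1/p) |z0|],
    and the triangle inequality concludes. *)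

(** * Real powers: inverses, convexity, monotonicity *)

Lemma powRVK (R : realType) (p x : R) : p != 0 -> 0 <= x ->
  (x `^ p^-1) `^ p = x.
Proof. by move=> p0 x0; rewrite -powRrM mulVf// powRr1. Qed.

Lemma powRKV (R : realType) (p x : R) : p != 0 -> 0 <= x ->
  (x `^ p) `^ p^-1 = x.
Proof. by move=> p0 x0; rewrite -powRrM mulfV// powRr1. Qed.

Lemma convex_powR_real (R : realType) (p s x y : R) : 1 <= p ->
  0 <= s <= 1 -> 0 <= x -> 0 <= y ->
  (s * x + (1 - s) * y) `^ p <= s * x `^ p + (1 - s) * y `^ p.
Proof.
move=> p1 /andP[s0 s1] x0 y0.
by apply: (convex_powR p1 (Itv01 s0 s1)); rewrite inE /= in_itv /= andbT.
Qed.

Lemma ler_powR_iff (R : realType) (p x y : R) : 0 < p -> 0 <= x -> 0 <= y ->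
  (x `^ p <= y `^ p) = (x <= y).
Proof.
move=> p0 x0 y0; apply/idP/idP; last by apply: ge0_ler_powR => //; exact: ltW.
by apply: contraTT; rewrite -!ltNge; apply: gt0_ltr_powR.
Qed.

(** * The norm axioms for [lpnorm] *)

Lemma lpnorm_ge0 (R : realType) (p : R) n (z : 'cV[R]_n) : 0 <= lpnorm p z.
Proof. exact: powR_ge0. Qed.

Lemma lpnorm_powR (R : realType) (p : R) n (z : 'cV[R]_n) : 0 < p ->
  lpnorm p z `^ p = \sum_(i < n) `|z i 0| `^ p.
Proof.
move=> p0; rewrite powRVK ?gt_eqF//.
by apply: sumr_ge0 => i _; exact: powR_ge0.
Qed.

Lemma le_lpnorm (R : realType) (p x : R) n (z : 'cV[R]_n) : 0 < p -> 0 <= x ->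
  \sum_(i < n) `|z i 0| `^ p <= x `^ p -> lpnorm p z <= x.
Proof. by move=> p0 x0; rewrite -lpnorm_powR// ler_powR_iff// lpnorm_ge0. Qed.

Lemma lpnorm0 (R : realType) (p : R) n : 0 < p -> lpnorm p (0 : 'cV[R]_n) = 0.
Proof.
move=> p0; apply/eqP; rewrite eq_le lpnorm_ge0 andbT; apply: le_lpnorm => //.
by rewrite big1 ?powR_ge0// => i _; rewrite mxE normr0 powR0// gt_eqF.
Qed.

Lemma lpnormN (R : realType) (p : R) n (z : 'cV[R]_n) :
  lpnorm p (- z) = lpnorm p z.
Proof. by congr (_ `^ _); apply: eq_bigr => i _; rewrite mxE normrN. Qed.

Lemma lpnormZ (R : realType) (p a : R) n (z : 'cV[R]_n) : 0 < p ->
  lpnorm p (a *: z) = `|a| * lpnorm p z.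
Proof.
move=> p0; rewrite /lpnorm.
under eq_bigr do rewrite mxE normrM powRM//.
rewrite -mulr_sumr powRM ?powR_ge0 ?powRKV ?gt_eqF//.
by apply: sumr_ge0 => i _; exact: powR_ge0.
Qed.

Lemma normr_le_lpnorm (R : realType) (p : R) n (z : 'cV[R]_n) i : 0 < p ->
  `|z i 0| <= lpnorm p z.
Proof.
move=> p0; rewrite -(ler_powR_iff p0)//; last exact: lpnorm_ge0.
rewrite lpnorm_powR// (bigD1 i)//= lerDl.
by apply: sumr_ge0 => j _; exact: powR_ge0.
Qed.

Lemma lpnorm_eq0 (R : realType) (p : R) n (z : 'cV[R]_n) : 0 < p ->
  lpnorm p z = 0 -> z = 0.
Proof.
move=> p0 z0; apply/colP => i; rewrite mxE; apply/eqP.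
by rewrite -normr_le0 -z0 normr_le_lpnorm.
Qed.

(** Minkowski's inequality, by convexity of the power. A vector of norm zero is zero, which settles
    the cases where normalisation would divide by zero. Otherwise the entries of [u] and [v] divided
    by their norms have [p]-th powers summing to 1, so summing the entrywise bounds leaves exactly
    [(a + b) ^ p]. *)
Lemma ler_lpnormD (R : realType) (p : R) n (u v : 'cV[R]_n) : 1 <= p ->
  lpnorm p (u + v) <= lpnorm p u + lpnorm p v.
Proof.
move=> p1; have p0 : 0 < p by exact: lt_le_trans p1.
have [/(lpnorm_eq0 p0)->|u0] := eqVneq (lpnorm p u) 0.
  by rewrite lpnorm0// !add0r.
have [/(lpnorm_eq0 p0)->|v0] := eqVneq (lpnorm p v) 0.
  by rewrite lpnorm0// !addr0.
have {u0}: 0 < lpnorm p u by rewrite lt0r u0 lpnorm_ge0.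
have {v0}: 0 < lpnorm p v by rewrite lt0r v0 lpnorm_ge0.
move bE : (lpnorm p v) => b b0; move aE : (lpnorm p u) => a a0.
have ab0 : 0 < a + b by rewrite addr_gt0.
apply: le_lpnorm => //; first exact: ltW.
pose s := a / (a + b).
have s01 : 0 <= s <= 1.
  by rewrite divr_ge0 ?(ltW a0) ?(ltW ab0)//= ler_pdivrMr// mul1r lerDl ltW.
have sE : 1 - s = b / (a + b) by rewrite /s; field; rewrite gt_eqF.
(* Convexity of the power is applied to the normalised entries
   |u_i| / a and |v_i| / b, with weights a / (a + b) and b / (a + b). *)
have le_i i : `|(u + v) i 0| `^ p <=
    (a + b) `^ p * (s * (`|u i 0| / a) `^ p + (1 - s) * (`|v i 0| / b) `^ p).
  apply: (@le_trans _ _ ((a + b) `^ p *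
      (s * (`|u i 0| / a) + (1 - s) * (`|v i 0| / b)) `^ p)); last first.
    rewrite ler_wpM2l ?powR_ge0// convex_powR_real// divr_ge0//; exact: ltW.
  rewrite -powRM; [|exact: ltW|]; last first.
    by rewrite sE addr_ge0// mulr_ge0// divr_ge0// ltW.
  rewrite ler_powR_iff//; last first.
    by rewrite mulr_ge0 ?(ltW ab0)// sE addr_ge0// mulr_ge0// divr_ge0// ltW.
  rewrite mxE (le_trans (ler_normD _ _))// sE /s.
  rewrite [leRHS](_ : _ = `|u i 0| + `|v i 0|)//.
  by field; rewrite !gt_eqF.
apply: (le_trans (ler_sum _ (fun i _ => le_i i))).
rewrite -mulr_sumr -[leRHS]mulr1 ler_wpM2l ?powR_ge0//.
have sum1 (w : 'cV[R]_n) c : 0 < c -> lpnorm p w = c ->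
    \sum_(i < n) (`|w i 0| / c) `^ p = 1.
  move=> c0 cE; under eq_bigr do rewrite powRM ?invr_ge0 ?(ltW c0)//.
  rewrite -mulr_suml -lpnorm_powR// cE -powRM ?invr_ge0 ?(ltW c0)//.
  by rewrite divff ?gt_eqF// powR1.
rewrite big_split/= -!mulr_sumr !sum1//.
by rewrite !mulr1 addrC subrK.
Qed.

Lemma ler_lpnormB (R : realType) (p : R) n (u v : 'cV[R]_n) : 1 <= p ->
  lpnorm p (u - v) <= lpnorm p u + lpnorm p v.
Proof. by move=> p1; rewrite -(lpnormN p v) ler_lpnormD. Qed.

Lemma ler_dist_lpnorm (R : realType) (p : R) n (u v : 'cV[R]_n) : 1 <= p ->
  `|lpnorm p u - lpnorm p v| <= lpnorm p (u - v).
Proof.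
move=> p1; have := ler_lpnormD (v - u) u p1; have := ler_lpnormD (u - v) v p1.
rewrite !subrK -[v - u]opprB lpnormN ler_norml => uv vu.
by rewrite lerBlDr uv andbT lerBrDr addrC lerBlDr addrC.
Qed.

(** * Operator bounds, continuity, and existence of a minimiser *)

Lemma ler_lpnorm_sum (R : realType) (p : R) n (I : Type) (r : seq I)
    (F : I -> 'cV[R]_n) : 1 <= p ->
  lpnorm p (\sum_(i <- r) F i) <= \sum_(i <- r) lpnorm p (F i).
Proof.
move=> p1; elim/big_rec2: _ => [|i x y _ yx].
  by rewrite lpnorm0// (lt_le_trans _ p1).
by rewrite (le_trans (ler_lpnormD _ _ p1))// lerD2l.
Qed.

(** A crude operator bound, from writing [M *m c] as a combination of the columns of [M]. It serves
    both as a Lipschitz constant and to confine a minimiser to a ball. *)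
Lemma ler_lpnorm_mulmx (R : realType) (p : R) n m (M : 'M[R]_(n, m))
    (c : 'cV[R]_m) (e : R) : 1 <= p -> (forall j, `|c j 0| <= e) ->
  lpnorm p (M *m c) <= (\sum_j lpnorm p (col j M)) * e.
Proof.
move=> p1 ce.
have -> : M *m c = \sum_j c j 0 *: col j M.
  apply/colP => i; rewrite summxE mxE.
  by apply: eq_bigr => j _; rewrite !mxE mulrC.
rewrite (le_trans (ler_lpnorm_sum _ _ p1))// mulr_suml.
apply: ler_sum => j _; rewrite lpnormZ ?(lt_le_trans _ p1)// mulrC.
by rewrite ler_wpM2l ?lpnorm_ge0.
Qed.

Lemma normr_mx_coord (R : realType) m n (x : 'M[R]_(m, n)) i j :
  `|x i j| <= `|x|.
Proof.
rewrite [leRHS]/Num.norm /= mx_normrE; apply/bigmax_geP; right => /=.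
by exists (i, j).
Qed.

Lemma continuous_lpnorm_affine (R : realType) (p : R) n m (M : 'M[R]_(n, m))
    (b : 'cV[R]_n) : 1 <= p ->
  continuous (fun x : 'rV[R]_m => lpnorm p (M *m x^T - b)).
Proof.
move=> p1 x; pose L := \sum_j lpnorm p (col j M).
have L0 : 0 <= L by apply: sumr_ge0 => j _; exact: lpnorm_ge0.
(* The map is [L]-Lipschitz; the radius uses [L + 1] because [L] may be 0. *)
apply/(cvgrPdist_lt (FF := nbhs_filter x)) => e e0; apply/nbhs_ballP; exists (e / (L + 1)) => /=.
  by rewrite divr_gt0// ltr_wpDl.
move=> y; rewrite -ball_normE /= => xy.
apply: (le_lt_trans (ler_dist_lpnorm _ _ p1)).
rewrite opprB addrA subrK -mulmxBr -linearB/=.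
have xy_le j : `|(x - y)^T j 0| <= `|x - y| by rewrite mxE normr_mx_coord.
apply: (le_lt_trans (ler_lpnorm_mulmx M p1 xy_le)); rewrite -/L.
apply: (@le_lt_trans _ _ ((L + 1) * `|x - y|)).
  by rewrite ler_wpM2r// lerDl.
by rewrite mulrC -ltr_pdivlMr ?ltr_wpDl.
Qed.

Lemma continuous_lpnorm_mulmx (R : realType) (p : R) n m (M : 'M[R]_(n, m)) :
  1 <= p -> continuous (fun x : 'rV[R]_m => lpnorm p (M *m x^T)).
Proof.
move=> p1; rewrite (_ : (fun x => _) = fun x => lpnorm p (M *m x^T - 0)).
  exact: continuous_lpnorm_affine.
by apply/funext => x; rewrite subr0.
Qed.

Lemma rat_rV_dense (R : realType) m (x : 'rV[R]_m) (e : R) : 0 < e ->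
  exists q : 'rV[rat]_m, ball x e (map_mx ratr q).
Proof.
move=> e0; have approx j : {q : rat | `|x 0 j - ratr q| < e}.
  apply/cid; have /rat_in_itvoo[q] : x 0 j - e < x 0 j + e by lra.
  rewrite in_itv/= => /andP[xq qx]; exists q.
  by rewrite ltr_norml; apply/andP; split; lra.
exists (\row_j projT1 (approx j)); split=> // i j.
by rewrite !mxE ord1; exact: projT2 (approx j).
Qed.

(** The set where the inequality fails is open, so if nonempty it would contain a rational vector.
    This reduces uncountable conditions to countable ones. *)
Lemma ler_rV_rat (R : realType) m (f g : 'rV[R]_m -> R) :
  continuous f -> continuous g ->
  (forall q : 'rV[rat]_m, f (map_mx ratr q) <= g (map_mx ratr q)) ->
  forall x, f x <= g x.
Proof.
move=> cf cg fg x; rewrite leNgt -subr_gt0; apply/negP => fgx.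
have : \forall y \near x, 0 < f y - g y.
  have fgx_cvg : (fun y => f y - g y) @ nbhs x --> f x - g x.
    exact: (continuousB (cf x) (cg x)).
  exact: (cvgr_gt (FF := nbhs_filter x) _ fgx_cvg) fgx.
move=> /nbhs_ballP[e /= e0] /= xe.
have [q /xe] := rat_rV_dense x e0.
by rewrite subr_gt0 ltNge fg.
Qed.

(** A kernel of [A] makes sublevel sets unbounded, so compactness cannot be used on them directly.
    The extreme value theorem is applied on a closed ball [K], and a generalised inverse [G], with
    [A G A = A], moves every serious competitor into [K]. *)
Lemma lpnorm_affine_min (R : realType) (p : R) n m (A : 'M[R]_(n, m))
    (b : 'cV[R]_n) : 1 <= p ->
  exists x0, forall x, lpnorm p (A *m x0 - b) <= lpnorm p (A *m x - b).
Proof.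
move=> p1; have p0 : 0 < p by exact: lt_le_trans p1.
pose G := pinvmx A; have AGA : A *m G *m A = A by rewrite mulmxKpV.
pose L := \sum_j lpnorm p (col j G).
have L0 : 0 <= L by apply: sumr_ge0 => j _; exact: lpnorm_ge0.
(* If [x] does at least as well as 0, its residual is at most the norm of [b], so [A x] has norm at
   most twice that of [b], and [G A x] lies in [K]. Any other [x] is beaten by 0, which is in
   [K]. *)
pose K := [set x : 'rV[R]_m | `|x| <= L * (lpnorm p b + lpnorm p b)].
have K0 : K 0.
  by rewrite /K /= normr0 mulr_ge0// addr_ge0 ?lpnorm_ge0.
have cK : compact K.
  apply: bounded_closed_compact.
    exists (L * (lpnorm p b + lpnorm p b)); split; first exact: num_real.
    by move=> M /ltW LM x /le_trans; apply.
  have -> : K = (Num.norm @^-1` [set y | y <= L * (lpnorm p b + lpnorm p b)]).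
    by [].
  by apply: closed_comp; [move=> x _; exact: norm_continuous|exact: closed_le].
have [x0 _ x0min] : exists2 c, c \in K & forall t, t \in K ->
    lpnorm p (A *m c^T - b) <= lpnorm p (A *m t^T - b).
  apply: EVT_min_rV cK _; first by exists 0.
  exact/continuous_subspaceT/continuous_lpnorm_affine.
exists x0^T => x.
(* Replacing x by G A x does not change A x, and makes the norm of x
   controlled by that of A x. *)
case/orP: (Order.TotalTheory.le_total (lpnorm p (A *m x - b)) (lpnorm p b)) => [xb|bx]; last first.
  apply: le_trans bx; have := x0min 0; rewrite inE trmx0 mulmx0 sub0r lpnormN.
  by apply.
have -> : A *m x = A *m (G *m (A *m x))^T^T.
  by rewrite trmxK mulmxA mulmxA AGA.
apply: x0min; rewrite inE /K /= /Num.norm /= mx_normrE.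
apply/bigmax_leP; split=> [|[i j] _ /=].
  by rewrite mulr_ge0// addr_ge0 ?lpnorm_ge0.
rewrite mxE ord1 (le_trans (normr_le_lpnorm _ _ p0))//.
apply: ler_lpnorm_mulmx => // k; rewrite (le_trans (normr_le_lpnorm _ _ p0))//.
have := ler_lpnormD (A *m x - b) b p1; rewrite subrK => /le_trans; apply.
rewrite lerD2r; exact: xb.
Qed.

(** * Subspaces: enlargement, column space, coordinates *)

Lemma extend_vspace (K : fieldType) (vT : vectType K) (U : {vspace vT})
    (r : nat) : (\dim U <= r)%N -> (r <= \dim {:vT})%N ->
  exists2 V : {vspace vT}, (U <= V)%VS & \dim V = r.
Proof.
(* Part of a basis of a complement of [U]: it is free and its span meets [U] trivially, so
   dimensions add up to [r]. *)
move=> Ur rn; pose X := take (r - \dim U) (vbasis U^C).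
have XUC : (<<X>> <= U^C)%VS.
  by apply/span_subvP => x /mem_take /vbasis_mem.
exists (U + <<X>>)%VS; first exact: addvSl.
rewrite dimv_disjoint_sum; last first.
  by apply/eqP; rewrite -subv0 -(capv_compl U) capvS.
have /eqP -> : free X.
  have := basis_free (vbasisP U^C).
  by rewrite -{1}(cat_take_drop (r - \dim U) (vbasis U^C)) => /catl_free.
rewrite size_take_min size_tuple dimv_compl (minn_idPl _) ?subnKC//.
exact: leq_sub2r.
Qed.

(** The factorisation [A = col_base A *m row_base A] puts the range in the span of only [\rank A]
    columns. *)
Lemma colspace (K : fieldType) n m (A : 'M[K]_(n, m)) :
  exists2 U : {vspace 'cV[K]_n}, (\dim U <= \rank A)%N &
    forall x : 'cV[K]_m, A *m x \in U.
Proof.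
exists <<[tuple col j (col_base A) | j < \rank A]>>%VS.
  by rewrite (leq_trans (dim_span _))// size_tuple.
move=> x; rewrite -{1}(mulmx_base A) -mulmxA; set c := row_base A *m x.
have -> : col_base A *m c = \sum_j c j 0 *: col j (col_base A).
  apply/colP => i; rewrite summxE mxE.
  by apply: eq_bigr => j _; rewrite !mxE mulrC.
apply: memv_suml => j _; apply/memvZ/memv_span.
by apply/mapP; exists j; rewrite ?mem_enum.
Qed.

(** Coordinates as row vectors, so that rational density applies to a general subspace. *)
Lemma vbasis_mxP (K : fieldType) n (V : {vspace 'cV[K]_n}) :
  exists B : 'M[K]_(n, \dim V), forall v,
    (v \in V) <-> exists c : 'rV[K]_(\dim V), v = B *m c^T.
Proof.
pose B := \matrix_(i < n, j < \dim V) (vbasis V)`_j i 0.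
have BE c : B *m c^T = \sum_j c 0 j *: (vbasis V)`_j.
  apply/colP => i; rewrite summxE mxE.
  by apply: eq_bigr => j _; rewrite !mxE mulrC.
exists B => v; split=> [vV|[c ->]].
  exists (\row_j coord (vbasis V) j v); rewrite BE {1}(coord_vbasis vV).
  by apply: eq_bigr => j _; rewrite mxE.
rewrite BE; apply: memv_suml => j _; apply/memvZ/vbasis_mem/mem_nth.
by rewrite size_tuple.
Qed.

(** * Measurability of random matrices and of the events *)

Lemma random_matrix_trmx (disp : measure_display) (T : measurableType disp)
    (R : realType) n k (X : T -> 'M[R]_(n, k)) :
  random_matrix X -> random_matrix (fun w => (X w)^T).
Proof. by move=> mX i j; under eq_fun do rewrite mxE; exact: mX. Qed.

Lemma random_matrix_cst (disp : measure_display) (T : measurableType disp)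
    (R : realType) n k (M : 'M[R]_(n, k)) : random_matrix (fun _ : T => M).
Proof. by move=> i j; exact: measurable_cst. Qed.

Lemma random_matrixB (disp : measure_display) (T : measurableType disp)
    (R : realType) n k (X Y : T -> 'M[R]_(n, k)) :
  random_matrix X -> random_matrix Y -> random_matrix (fun w => X w - Y w).
Proof.
move=> mX mY i j; under eq_fun do rewrite !mxE.
by apply: measurable_funB; [exact: mX|exact: mY].
Qed.

Lemma random_matrixM (disp : measure_display) (T : measurableType disp)
    (R : realType) n k m (X : T -> 'M[R]_(n, k)) (Y : T -> 'M[R]_(k, m)) :
  random_matrix X -> random_matrix Y -> random_matrix (fun w => X w *m Y w).
Proof.
move=> mX mY i j; under eq_fun do rewrite !mxE.
by apply: measurable_sum => l; apply: measurable_funM; [exact: mX|exact: mY].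
Qed.

Lemma measurable_lpnorm (disp : measure_display) (T : measurableType disp)
    (R : realType) (p : R) n (X : T -> 'cV[R]_n) :
  random_matrix X -> measurable_fun setT (fun w => lpnorm p (X w)).
Proof.
move=> mX; apply: (measurableT_comp (measurable_powR _)).
apply: measurable_sum => i; apply: (measurableT_comp (measurable_powR _)).
by apply: measurableT_comp => //; exact: mX.
Qed.

(** Both sides are continuous in the coordinates of [v], so testing rational coordinates suffices
    and the event is a countable intersection. *)
Lemma measurable_injectivity (disp : measure_display)
    (T : measurableType disp) (R : realType) (p : R) n k (a : R)
    (X : T -> 'M[R]_(k, n)) (V : {vspace 'cV[R]_n}) : 1 <= p ->
  random_matrix X ->
  measurable [set w | forall v, v \in V ->
    a * lpnorm p v <= lpnorm p (X w *m v)].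
Proof.
move=> p1 mX; have [B BV] := vbasis_mxP V.
pose v q := B *m (map_mx ratr q : 'rV[R]_(\dim V))^T.
have -> : [set w | forall v, v \in V -> a * lpnorm p v <= lpnorm p (X w *m v)]
    = \bigcap_(q in [set: 'rV[rat]_(\dim V)])
        [set w | a * lpnorm p (v q) <= lpnorm p (X w *m v q)].
  apply/seteqP; split=> w Xw.
    by move=> q _; apply: Xw; apply/BV; eexists.
  move=> _ /BV[c ->]; move: c; apply: ler_rV_rat => [c|c|q]; last exact: Xw.
    have /(_ c) Bc := @continuous_lpnorm_mulmx R p n (\dim V) B p1.
    exact: (cvgMr (FF := nbhs_filter c) Bc).
  by under eq_fun do rewrite mulmxA; exact: continuous_lpnorm_mulmx.
rewrite -[X in measurable X]setCK setC_bigcap; apply: measurableC.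
apply: countable_bigcupT_measurable => // q; apply: measurableC.
rewrite -[X in measurable X]setTI.
apply: measurable_fun_le => //.
exact/measurable_lpnorm/random_matrixM/random_matrix_cst.
Qed.

(** * The deterministic error bound *)

Lemma ler_powR_root (R : realType) (p a x y : R) : 0 < p -> 0 <= a -> 0 <= x ->
  0 <= y -> (a * x `^ p <= y `^ p) = (a `^ p^-1 * x <= y).
Proof.
move=> p0 a0 x0 y0; rewrite -{1}(@powRVK _ p a) ?gt_eqF// -powRM ?powR_ge0//.
by rewrite ler_powR_iff// mulr_ge0 ?powR_ge0.
Qed.

(** Here [M] is the transposed sketch at a single outcome where injectivity and the Markov bound
    both hold. *)
Lemma sketch_and_solve_bound (R : realType) (p alpha t : R) n d k
    (M : 'M[R]_(k, n)) (A : 'M[R]_(n, d)) (b : 'cV[R]_n) (x x0 : 'cV[R]_d) :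
  1 <= p -> 0 < alpha -> 0 <= t ->
  alpha `^ p^-1 * lpnorm p (A *m (x - x0)) <= lpnorm p (M *m (A *m (x - x0))) ->
  lpnorm p (M *m (A *m x0 - b)) <= t `^ p^-1 * lpnorm p (A *m x0 - b) ->
  lpnorm p (M *m (A *m x - b)) <= lpnorm p (M *m (A *m x0 - b)) ->
  lpnorm p (A *m x - b) <= (1 + 2 * (t / alpha) `^ p^-1) * lpnorm p (A *m x0 - b).
Proof.
move=> p1 a0 t0.
have -> : A *m (x - x0) = (A *m x - b) - (A *m x0 - b).
  by rewrite mulmxBr opprB addrA subrK.
(* Exposes the factor [alpha ^ (1/p)], cancelled at the end against the injectivity constant. *)
have : t `^ p^-1 = (t / alpha) `^ p^-1 * alpha `^ p^-1.
  by rewrite -powRM ?divr_ge0 ?divfK ?gt_eqF// ltW.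
have : 0 < alpha `^ p^-1 by exact: powR_gt0.
move: (alpha `^ p^-1) ((t / alpha) `^ p^-1) => al s al0 ->.
set z := A *m x - b; set z0 := A *m x0 - b => inj iso opt.
have Mtri : lpnorm p (M *m (z - z0)) <= lpnorm p (M *m z) + lpnorm p (M *m z0).
  by rewrite mulmxBr; exact: ler_lpnormB.
have tri : lpnorm p z <= lpnorm p (z - z0) + lpnorm p z0.
  by have := ler_lpnormD (z - z0) z0 p1; rewrite subrK.
apply: (le_trans tri); rewrite addrC mulrDl mul1r lerD2l.
rewrite -(ler_pM2l al0) (le_trans inj)// (le_trans Mtri)//.
apply: (le_trans (lerD opt (lexx _))); rewrite -mulr2n -[leLHS]mulr_natl.
have -> : al * (2 * s * lpnorm p z0) = 2 * (s * al * lpnorm p z0) by ring.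
by rewrite ler_pM2l.
Qed.

(** * Union bound and Markov's inequality *)

Lemma probability_setI_ge (disp : measure_display) (T : measurableType disp)
    (R : realType) (P : probability T R) (E F : set T) (x y : R) :
  measurable E -> measurable F ->
  ((1 - x)%:E <= P E)%E -> ((1 - y)%:E <= P F)%E ->
  ((1 - x - y)%:E <= P (E `&` F))%E.
Proof.
move=> mE mF PE PF; have mEF : measurable (E `&` F) by exact: measurableI.
have : (P (~` (E `&` F)) <= P (~` E) + P (~` F))%E.
  by rewrite setCI; apply: measureU2; exact: measurableC.
rewrite !probability_setC//; move: PE PF.
rewrite -(fineK (fin_num_measure P _ mE)) -(fineK (fin_num_measure P _ mF)).
rewrite -(fineK (fin_num_measure P _ mEF)) -!EFinB -EFinD !lee_fin; lra.
Qed.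

(** Markov controls the event [t * e <= X], which contains the complement of the event of interest;
    [0 < e] allows division by [t * e]. *)
Lemma markov_complement (disp : measure_display) (T : measurableType disp)
    (R : realType) (P : probability T R) (X : T -> R) (e t : R) :
  measurable_fun setT X -> (forall w, 0 <= X w) -> ('E_P[X] = e%:E)%E ->
  0 < e -> 0 < t -> ((1 - t^-1)%:E <= P [set w | (X w <= t * e)%R])%E.
Proof.
move=> mX X0 EX e0 t0; have te0 : 0 < t * e by exact: mulr_gt0.
have mle : measurable [set w | (X w <= t * e)%R].
  rewrite -[X in measurable X]setTI.
  exact: measurable_fun_le.
have mge : measurable [set w | (t * e <= X w)%R].
  rewrite -[X in measurable X]setTI.
  exact: measurable_fun_le.
have : (P (~` [set w | (X w <= t * e)%R]) <= P [set w | (t * e <= X w)%R])%E.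
  apply: le_measure; rewrite ?inE//; first exact: measurableC.
  by move=> w /= /negP; rewrite -ltNge => /ltW.
have : ((t * e)%:E * P [set w | (t * e <= X w)%R] <= e%:E)%E.
  have mEX : measurable_fun setT (EFin \o X) by exact/measurable_EFinP.
  have := le_integral_abse P measurableT mEX te0.
  have -> : (\int[P]_w `|(EFin \o X) w| = e%:E)%E.
    rewrite -EX expectation.unlock; apply: eq_integral => w _ /=.
    by rewrite ger0_norm.
  apply: le_trans; rewrite setTI le_eqVlt; apply/orP; left; apply/eqP.
  congr (_ * P _)%E; apply/seteqP.
  by split=> w /=; rewrite lee_fin ger0_norm.
rewrite probability_setC//.
rewrite -(fineK (fin_num_measure P _ mle)) -(fineK (fin_num_measure P _ mge)).
rewrite -EFinM -EFinB !lee_fin => teP Ple.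
have : fine (P [set w | (t * e <= X w)%R]) <= t^-1.
  by rewrite -(ler_pM2l te0) (le_trans teP)// mulrAC mulfV ?gt_eqF// mul1r.
lra.
Qed.

Theorem corollary5p3 (disp : measure_display) (T : measurableType disp)
    (R : realType) (P : probability T R) (p : R) (n d k r : nat)
    (alpha rho : R) (A : 'M[R]_(n, d)) (b : 'cV[R]_n)
    (Omega : T -> 'M[R]_(n, k)) (xt : T -> 'cV[R]_d)
    (p_ge1 : 1 <= p)
    (rankA : (\rank A <= r)%N) (r_ge1 : (1 <= r)%N) (r_le_n : (r <= n)%N)
    (alpha_gt0 : 0 < alpha) (alpha_le1 : alpha <= 1)
    (rho_ge0 : 0 <= rho) (rho_lt1 : rho < 1)
    (OmegaOSI : OSI P p r alpha rho Omega)
    (xt_random : random_matrix xt)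
    (xt_argmin : forall w : T,
       argmin (fun x : 'cV[R]_d => lpnorm p ((Omega w)^T *m (A *m x - b)))
         (xt w)) :
  exists2 m : R,
    is_min (range (fun x : 'cV[R]_d => lpnorm p (A *m x - b))) m &
    (forall t : R, 1 <= t ->
      ((1 - rho - t^-1)%:E <=
        P [set w | (lpnorm p (A *m xt w - b)
                     <= (1 + 2 * (t / alpha) `^ p^-1) * m)%R])%E)
    /\
    (forall delta : R, 0 < delta -> delta < 1 -> rho <= delta / 2 ->
      ((1 - delta)%:E <=
        P [set w | (lpnorm p (A *m xt w - b)
                     <= (1 + 2 * (2 / (alpha * delta)) `^ p^-1) * m)%R])%E).
Proof.
have [mO isoO injO] := OmegaOSI; have p0 : 0 < p by exact: lt_le_trans p_ge1.
have [x0 x0min] := lpnorm_affine_min A b p_ge1.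
exists (lpnorm p (A *m x0 - b)); first by split; [exists x0|move=> _ [x _ <-]].
have main t : 1 <= t -> ((1 - rho - t^-1)%:E <=
    P [set w | (lpnorm p (A *m xt w - b)
      <= (1 + 2 * (t / alpha) `^ p^-1) * lpnorm p (A *m x0 - b))%R])%E.
  move=> t1; have t0 : 0 < t by exact: lt_le_trans t1.
  have [U Udim AU] := colspace A.
  (* Injectivity is assumed for dimension exactly [r], while [A] may have smaller rank. *)
  have [V UV Vdim] : exists2 V : {vspace 'cV[R]_n}, (U <= V)%VS & \dim V = r.
    apply: extend_vspace; first exact: leq_trans Udim rankA.
    by rewrite dimvf dim_matrix mulr1.
  have mOT := random_matrix_trmx mO.
  (* The injectivity event with [p]-th roots taken, as the deterministic bound requires. *)
  pose E := [set w | forall v, v \in V ->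
    alpha `^ p^-1 * lpnorm p v <= lpnorm p ((Omega w)^T *m v)].
  have mE : measurable E by exact: measurable_injectivity.
  have PE : ((1 - rho)%:E <= P E)%E.
    apply: le_trans (injO V Vdim) _; rewrite le_eqVlt; apply/orP; left.
    apply/eqP; congr (P _); apply/seteqP; split=> w /= inj v /inj.
      by rewrite ler_powR_root ?lpnorm_ge0// ltW.
    by rewrite ler_powR_root ?lpnorm_ge0// ltW.
  pose z0 := A *m x0 - b.
  pose F := [set w | lpnorm p ((Omega w)^T *m z0) `^ p <= t * lpnorm p z0 `^ p].
  have mOz : measurable_fun setT (fun w => lpnorm p ((Omega w)^T *m z0) `^ p).
    apply: (measurableT_comp (measurable_powR _)).
    exact/measurable_lpnorm/random_matrixM/random_matrix_cst.
  have mF : measurable F.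
    rewrite -[X in measurable X]setTI.
    exact: measurable_fun_le.
  have PF : ((1 - t^-1)%:E <= P F)%E.
    (* When [z0 = 0] the expectation is 0 and Markov does not apply, but [F] is then the whole
       space. *)
    have [z00|z0_neq0] := eqVneq z0 0.
      rewrite (_ : F = setT) ?probability_setT ?lee_fin ?gerBl ?invr_ge0 ?ltW//.
      apply/seteqP; split=> // w _; rewrite /F /= z00 mulmx0 !lpnorm0//.
      by rewrite powR0 ?gt_eqF// mulr0.
    apply: markov_complement (isoO z0) _ t0 => // [w|]; first exact: powR_ge0.
    rewrite powR_gt0// lt0r lpnorm_ge0 andbT.
    by apply: contra_neq z0_neq0; exact: lpnorm_eq0.
  apply: le_trans (probability_setI_ge mE mF PE PF) _.
  apply: le_measure; rewrite ?inE; first exact: measurableI.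
    rewrite -[X in measurable X]setTI.
    apply: measurable_fun_le => //.
    apply/measurable_lpnorm/random_matrixB/random_matrix_cst.
    exact/random_matrixM/xt_random/random_matrix_cst.
  move=> w [Ew Fw]; rewrite /=.
  (* The vector [A (xt - x0)] depends on the outcome, but [V] does not, and [E] is uniform over
     [V]. *)
  apply: (sketch_and_solve_bound p_ge1 alpha_gt0 (ltW t0) _ _ (xt_argmin w x0)).
    by apply: Ew; apply: (subvP UV).
  rewrite -(ler_powR_iff p0) ?lpnorm_ge0 ?mulr_ge0 ?powR_ge0//.
  rewrite powRM ?powR_ge0 ?lpnorm_ge0// (@powRVK _ p t) ?gt_eqF ?(ltW t0)//.
split=> // delta delta0 delta1 rho_le.
have t1 : 1 <= 2 / delta by rewrite ler_pdivlMr// mul1r; lra.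
(* With [t = 2 / delta], the failure probability [rho + 1 / t] is at most
   [delta / 2 + delta / 2]. *)
have := main _ t1; rewrite -mulrA -invfM [delta * _]mulrC; apply: le_trans.
by rewrite lee_fin invf_div; lra.
Qed.
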